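(* With the problem (LDR), the feasible set $\mathcal F_M$, and the matrices $\mathcal Q$ and $\mathcal H$ defined in the context, the following 0-1 semidefinite program is a conservative approximation of (LDR), i.e. its optimal value is an upper bound on that of (LDR): $$\min\ w^\top x+r+t$$ over $(Q,q,r,t,Y,y_0,p_0,\lambda,T,\Lambda,(\theta_i,\Gamma_i,\omega_i,\rho_i)_{i=1}^d,x)\in\mathcal F_M$ and symmetric $U\in\mathbb R^{l\times l}$, subject to $$r\,e_{k+1}e_{k+1}^\top-\mathcal Q=\mathcal H^\top U\mathcal H,\qquad U\ge0\ \text{(entrywise)}.$$
   Context: Data. $\mathcal X\subseteq\{0,1\}^d$, $w\in\mathbb R^d$, $A\in\mathbb R^{m\times n}$; $c(\xi)=C\xi+c_0$, $v(\xi)=V\xi+v_0$ with $C,V\in\mathbb R^{n\times k}$, $c_0,v_0\in\mathbb R^n$; $b_x(\xi)=B_x\xi+b_{x0}$ with $B_x=\sum_{i=1}^dB_ix_i+B_0$, $b_{x0}=\sum_{i=1}^db_ix_i+b_0$, $B_i\in\mathbb R^{m\times k}$, $b_i\in\mathbb R^m$. The support set is $\mathcal S=\{\xi\in\mathbb R^k: W\xi\ge h\}$, $W\in\mathbb R^{l\times k}$, $h\in\mathbb R^l$, assumed compact. $\mu_0\in\mathbb R^k$, $\Sigma_0\in\mathbb R^{k\times k}$ symmetric positive definite (empirical mean and covariance), $\gamma_1\ge0$, $\gamma_2\ge1$. The ambiguity set $\mathcal D_M$ is the set of all probability measures $F$ with $\mathbb P_F(\xi\in\mathcal S)=1$, $(\mathbb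 E_F[\xi]-\mu_0)^\top\Sigma_0^{-1}(\mathbb E_F[\xi]-\mu_0)\le\gamma_1$, $\mathbb E_F[(\xi-\mu_0)(\xi-\mu_0)^\top]\preceq\gamma_2\Sigma_0$. Standing assumptions. $c(\xi),v(\xi),b_x(\xi)$ are square-integrable under every $F\in\mathcal D_M$, and for every $x\in\mathcal X$ and $F\in\mathcal D_M$ the set $\{y\in\mathbb R^n:Ay\le b_x(\xi)\}$ is almost surely nonempty and bounded. The polyhedral cone $\hat\Xi=\{z\in\mathbb R^{k+1}:\mathcal Hz\ge0\}$, with $\mathcal H=[W\,|\,-h]\in\mathbb R^{l\times(k+1)}$, is full dimensional (no implicit equalities). Problem (LDR) (linear decision rules $y(\xi)=Y\xi+y_0$, $p(\xi)=P\xi+p_0$): $$\min_{x\in\mathcal X,\ \lambda\ge0,\ P\in\mathbb R^{m\times k},\ p_0\in\mathbb R^m,\ Y\in\mathbb R^{n\times k},\ y_0\in\mathbb R^n}\ w^\top x+\sup_{F\in\mathcal D_M}\mathbb E_F[b_x(\xi)^\top p(\xi)+c(\xi)^\top y(\xi)]$$ subject to $A^\top p(\xi)+\lambda c(\xi)=v(\xi)$, $p(\xi)\ge0$, $Ay(\xi)\le\lambda b_x(\xi)$ for all $\xi\in\mathcal S$. The set $\mathcal F_M$. Let $M>0$ be a sufficiently large (big-M) constant; $\mathbf 1_r$ is the all-ones vector in $\mathbb R^r$, $\mathbf 1_{k\times k}$ the all-ones matrix; vector/matrix inequalities $\le,\ge$ are entrywise; $X\cdot Y=\mathrm{Tr}(X^\top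 Y)$; $\|\cdot\|$ is the Euclidean norm. $\mathcal F_M$ is the set of tuples with $Q\in\mathbb R^{k\times k}$ symmetric, $q\in\mathbb R^k$, $r,t,\lambda\in\mathbb R$, $Y\in\mathbb R^{n\times k}$, $y_0\in\mathbb R^n$, $p_0\in\mathbb R^m$, $T,\Lambda\in\mathbb R^{m\times l}$, $\theta_i\in\mathbb R$, $\Gamma_i\in\mathbb R^{k\times k}$, $\omega_i\in\mathbb R^m$, $\rho_i\in\mathbb R^k$, $x\in\mathcal X$ satisfying: - $t\ge(\gamma_2\Sigma_0+\mu_0\mu_0^\top)\cdot Q+\mu_0^\top q+\sqrt{\gamma_1}\,\|\Sigma_0^{1/2}(q+2Q\mu_0)\|$, $Q\succeq0$, $\lambda\ge0$; - for $i=1,\dots,d$: $B_i^\top TW-(1-x_i)M\mathbf 1_{k\times k}\le\Gamma_i\le B_i^\top TW+(1-x_i)M\mathbf 1_{k\times k}$, $-x_iM\mathbf 1_{k\times k}\le\Gamma_i\le x_iM\mathbf 1_{k\times k}$; - for $i=1,\dots,d$: $\lambda-M(1-x_i)\le\theta_i\le Mx_i$, $0\le\theta_i\le\lambda$; - for $i=1,\dots,d$: $p_0-(1-x_i)M\mathbf 1_m\le\omega_i\le p_0+(1-x_i)M\mathbf 1_m$, $-x_iM\mathbf 1_m\le\omega_i\le x_iM\mathbf 1_m$; - for $i=1,\dots,d$: $(TW)^\top b_i-(1-x_i)M\mathbf 1_k\le\rho_i\le(TW)^\top b_i+(1-x_i)M\mathbf 1_k$, $-x_iM\mathbf 1_k\le\rho_i\le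 x_iM\mathbf 1_k$; - $AY+\Lambda W=\sum_{i=1}^d\theta_iB_i+\lambda B_0$, $\Lambda h-Ay_0+\sum_{i=1}^d\theta_ib_i+\lambda b_0\ge0$, $\Lambda\ge0$; - $A^\top TW+\lambda C=V$, $A^\top p_0+\lambda c_0=v_0$, $Th+p_0\ge0$, $T\ge0$. The matrix $\mathcal Q$ (symmetric, of order $k+1$) is $$\mathcal Q=\begin{bmatrix}\tfrac12(N+N^\top)-Q & g\\ g^\top & b_{x0}^\top p_0+c_0^\top y_0\end{bmatrix},\quad N=\sum_{i=1}^d\Gamma_i+B_0^\top TW+C^\top Y,$$ $$g=\tfrac12\Big(\sum_{i=1}^dB_i^\top\omega_i+B_0^\top p_0+\sum_{i=1}^d\rho_i+(TW)^\top b_0+C^\top y_0+Y^\top c_0-q\Big).$$ $e_{k+1}\in\mathbb R^{k+1}$ is the last standard basis vector. *)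

(* Defs.v *)
From HB Require Import structures.
From mathcomp Require Import all_boot all_order all_algebra.
From mathcomp Require Import all_classical all_reals all_analysis.

Set Implicit Arguments.
Unset Strict Implicit.
Unset Printing Implicit Defensive.

Import Order.TTheory GRing.Theory Num.Theory.
Import numFieldNormedType.Exports.

Local Open Scope classical_set_scope.
Local Open Scope ring_scope.

Section Matrices.
Context {R : realType}.

Definition dotv {n} (u v : 'cV[R]_n) : R := (u^T *m v) 0 0.

(* The library norm on matrices is the sup norm, hence this definition. *)
Definition enorm {n} (u : 'cV[R]_n) : R := Num.sqrt (dotv u u).

Definition mxdot {m n} (X Y : 'M[R]_(m, n)) : R := \tr (X^T *m Y).

Definition mxle {m n} (X Y : 'M[R]_(m, n)) : Prop :=
  forall i j, X i j <= Y i j.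

Definition psdmx {n} (X : 'M[R]_n) : Prop :=
  X^T = X /\ forall z : 'cV[R]_n, 0 <= dotv z (X *m z).

Definition pdmx {n} (X : 'M[R]_n) : Prop :=
  X^T = X /\ forall z : 'cV[R]_n, z != 0 -> 0 < dotv z (X *m z).

Definition loewner_le {n} (X Y : 'M[R]_n) : Prop := psdmx (Y - X).

(* The principal square root: it exists and is unique for positive
   semidefinite X. *)
Definition mxsqrt {n} (X : 'M[R]_n) : 'M[R]_n :=
  xget 0 [set S | psdmx S /\ S *m S = X].

(* For a convex set, nonempty interior amounts to an affine hull of dimension
   n. For a polyhedral cone {z | H z >= 0} it holds as soon as no row of H is
   an implicit equality; the converse holds unless H has a zero row. *)
Definition full_dimensional {n} (K : set 'cV[R]_n) : Prop :=
  interior K !=set0.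

Definition binary_cube {d : nat} : set 'cV[R]_d :=
  [set x : 'cV[R]_d | forall i, x i 0 = 0 \/ x i 0 = 1].

End Matrices.

Notation "X <=mx Y" := (mxle X Y) (at level 70, no associativity) : ring_scope.

(* R^k with its Borel sigma-algebra. *)
Definition borel_cV (R : realType) (k : nat) :=
  g_sigma_algebraType (@open 'cV[R]_k).

(* d: binary decisions, n: dimension of y, m: rows of A, k: dimension of xi,
   l: rows of W. *)
Record ldr_data (R : realType) (d n m k l : nat) := LdrData {
  dX : set 'cV[R]_d;
  dw : 'cV[R]_d;
  dA : 'M[R]_(m, n);
  dC : 'M[R]_(n, k);
  dc0 : 'cV[R]_n;
  dV : 'M[R]_(n, k);
  dv0 : 'cV[R]_n;
  dB : 'I_d -> 'M[R]_(m, k);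
  dB0 : 'M[R]_(m, k);
  db : 'I_d -> 'cV[R]_m;
  db0 : 'cV[R]_m;
  dW : 'M[R]_(l, k);
  dh : 'cV[R]_l;
  dmu0 : 'cV[R]_k;
  dSigma0 : 'M[R]_k;
  dgamma1 : R;
  dgamma2 : R
}.

Record ldr_var (R : realType) (d n m k : nat) := LdrVar {
  ldr_x : 'cV[R]_d;
  ldr_lam : R;
  ldr_P : 'M[R]_(m, k);
  ldr_p0 : 'cV[R]_m;
  ldr_Y : 'M[R]_(n, k);
  ldr_y0 : 'cV[R]_n
}.

Record sdp_var (R : realType) (d n m k l : nat) := SdpVar {
  vQ : 'M[R]_k;
  vq : 'cV[R]_k;
  vr : R;
  vt : R;
  vY : 'M[R]_(n, k);
  vy0 : 'cV[R]_n;
  vp0 : 'cV[R]_m;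
  vlam : R;
  vT : 'M[R]_(m, l);
  vLam : 'M[R]_(m, l);
  vtheta : 'I_d -> R;
  vGam : 'I_d -> 'M[R]_k;
  vomega : 'I_d -> 'cV[R]_m;
  vrho : 'I_d -> 'cV[R]_k;
  vx : 'cV[R]_d
}.

Section Problem.
Context {R : realType} {d n m k l : nat}.
Variable D : ldr_data R d n m k l.

Local Notation A := (dA D).
Local Notation C := (dC D).
Local Notation c0 := (dc0 D).
Local Notation V := (dV D).
Local Notation v0 := (dv0 D).
Local Notation B := (dB D).
Local Notation B0 := (dB0 D).
Local Notation b := (db D).
Local Notation b0 := (db0 D).
Local Notation W := (dW D).
Local Notation h := (dh D).
Local Notation mu0 := (dmu0 D).
Local Notation Sigma0 := (dSigma0 D).
Local Notation gamma1 := (dgamma1 D).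
Local Notation gamma2 := (dgamma2 D).

Definition cfun (xi : 'cV[R]_k) : 'cV[R]_n := C *m xi + c0.

Definition vfun (xi : 'cV[R]_k) : 'cV[R]_n := V *m xi + v0.

Definition Bx (x : 'cV[R]_d) : 'M[R]_(m, k) :=
  \sum_(i < d) x i 0 *: B i + B0.

Definition bx0 (x : 'cV[R]_d) : 'cV[R]_m :=
  \sum_(i < d) x i 0 *: b i + b0.

Definition bfun (x : 'cV[R]_d) (xi : 'cV[R]_k) : 'cV[R]_m :=
  Bx x *m xi + bx0 x.

Definition support_set : set 'cV[R]_k := [set xi | h <=mx W *m xi].

Definition Hmx : 'M[R]_(l, k + 1) := row_mx W (- h).

Definition Xihat : set 'cV[R]_(k + 1) := [set z | 0 <=mx Hmx *m z].

(* [fine] is harmless here: both moments are only used for laws carried by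
   the support set, which is assumed compact. *)
Definition mean (F : probability (borel_cV R k) R) : 'cV[R]_k :=
  \col_i fine ('E_F[fun xi : 'cV[R]_k => (xi i 0)%R])%E.

Definition second_moment (F : probability (borel_cV R k) R) : 'M[R]_k :=
  \matrix_(i, j)
    fine ('E_F[fun xi : 'cV[R]_k => ((xi - mu0) i 0 * (xi - mu0) j 0)%R])%E.

Definition ambiguity_set : set (probability (borel_cV R k) R) :=
  [set F : probability (borel_cV R k) R | [/\ F support_set = 1%E,
     dotv (mean F - mu0) (invmx Sigma0 *m (mean F - mu0)) <= gamma1
   & loewner_le (second_moment F) (gamma2 *: Sigma0)]].

Definition square_integrable (p : nat)
    (F : probability (borel_cV R k) R) (f : 'cV[R]_k -> 'cV[R]_p) : Prop :=
  forall i, (fun xi => f xi i 0) \in @Lfun _ (borel_cV R k) R F 2%:E.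

Definition lower_set (x : 'cV[R]_d) (xi : 'cV[R]_k) : set 'cV[R]_n :=
  [set y | A *m y <=mx bfun x xi].

Definition ldr_pfun (s : ldr_var R d n m k) (xi : 'cV[R]_k) : 'cV[R]_m :=
  ldr_P s *m xi + ldr_p0 s.

Definition ldr_yfun (s : ldr_var R d n m k) (xi : 'cV[R]_k) : 'cV[R]_n :=
  ldr_Y s *m xi + ldr_y0 s.

Definition ldr_feasible : set (ldr_var R d n m k) :=
  [set s | [/\ dX D (ldr_x s), 0 <= ldr_lam s
   & forall xi, support_set xi ->
     [/\ A^T *m ldr_pfun s xi + ldr_lam s *: cfun xi = vfun xi,
         0 <=mx ldr_pfun s xi
       & A *m ldr_yfun s xi <=mx ldr_lam s *: bfun (ldr_x s) xi]]].

Definition ldr_objective (s : ldr_var R d n m k) : \bar R :=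
  ((dotv (dw D) (ldr_x s))%:E +
   ereal_sup [set 'E_F[fun xi : 'cV[R]_k =>
       (dotv (bfun (ldr_x s) xi) (ldr_pfun s xi) +
        dotv (cfun xi) (ldr_yfun s xi))%R]
     | F in ambiguity_set])%E.

Definition ldr_value : \bar R :=
  ereal_inf [set ldr_objective s | s in ldr_feasible].

Definition FM (M : R) : set (sdp_var R d n m k l) :=
  [set z |
   let x := vx z in
   let lam := vlam z in
   let TW := vT z *m W in
   let ones p q : 'M[R]_(p, q) := const_mx 1 in
   dX D x /\
   [/\ mxdot (gamma2 *: Sigma0 + mu0 *m mu0^T) (vQ z) + dotv mu0 (vq z)
         + Num.sqrt gamma1
           * enorm (mxsqrt Sigma0 *m (vq z + 2 *: (vQ z *m mu0))) <= vt z,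
       psdmx (vQ z) & 0 <= lam] /\
   (forall i : 'I_d,
     [/\ (B i)^T *m TW - ((1 - x i 0) * M) *: ones k k <=mx vGam z i,
         vGam z i <=mx (B i)^T *m TW + ((1 - x i 0) * M) *: ones k k,
         - ((x i 0 * M) *: ones k k) <=mx vGam z i
       & vGam z i <=mx (x i 0 * M) *: ones k k]) /\
   (forall i : 'I_d,
     [/\ lam - M * (1 - x i 0) <= vtheta z i,
         vtheta z i <= M * x i 0,
         0 <= vtheta z i
       & vtheta z i <= lam]) /\
   (forall i : 'I_d,
     [/\ vp0 z - ((1 - x i 0) * M) *: ones m 1 <=mx vomega z i,
         vomega z i <=mx vp0 z + ((1 - x i 0) * M) *: ones m 1,
         - ((x i 0 * M) *: ones m 1) <=mx vomega z i
       & vomega z i <=mx (x i 0 * M) *: ones m 1]) /\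
   (forall i : 'I_d,
     [/\ TW^T *m b i - ((1 - x i 0) * M) *: ones k 1 <=mx vrho z i,
         vrho z i <=mx TW^T *m b i + ((1 - x i 0) * M) *: ones k 1,
         - ((x i 0 * M) *: ones k 1) <=mx vrho z i
       & vrho z i <=mx (x i 0 * M) *: ones k 1]) /\
   [/\ A *m vY z + vLam z *m W = \sum_(i < d) vtheta z i *: B i + lam *: B0,
       0 <=mx vLam z *m h - A *m vy0 z
                + \sum_(i < d) vtheta z i *: b i + lam *: b0
     & 0 <=mx vLam z] /\
   [/\ A^T *m TW + lam *: C = V,
       A^T *m vp0 z + lam *: c0 = v0,
       0 <=mx vT z *m h + vp0 z
     & 0 <=mx vT z]].

Definition Nmx (z : sdp_var R d n m k l) : 'M[R]_k :=
  \sum_(i < d) vGam z i + B0^T *m (vT z *m W) + C^T *m vY z.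

Definition gvec (z : sdp_var R d n m k l) : 'cV[R]_k :=
  2^-1 *: (\sum_(i < d) (B i)^T *m vomega z i + B0^T *m vp0 z
           + \sum_(i < d) vrho z i + (vT z *m W)^T *m b0
           + C^T *m vy0 z + (vY z)^T *m c0 - vq z).

Definition calQ (z : sdp_var R d n m k l) : 'M[R]_(k + 1) :=
  block_mx (2^-1 *: (Nmx z + (Nmx z)^T) - vQ z) (gvec z)
           (gvec z)^T (dotv (bx0 (vx z)) (vp0 z) + dotv c0 (vy0 z))%:M.

Definition e_last : 'cV[R]_(k + 1) := delta_mx (rshift k ord0) ord0.

Definition sdp_feasible (M : R) : set (sdp_var R d n m k l * 'M[R]_l) :=
  [set zU | let: (z, U) := zU in
   [/\ FM M z, U^T = U,
       vr z *: (e_last *m e_last^T) - calQ z = Hmx^T *m U *m Hmx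
     & 0 <=mx U]].

Definition sdp_objective (z : sdp_var R d n m k l) : R :=
  dotv (dw D) (vx z) + vr z + vt z.

Definition sdp_value (M : R) : \bar R :=
  ereal_inf [set (sdp_objective zU.1)%:E | zU in sdp_feasible M].

End Problem.

(* Main.v *)
Require Import Defs.
From HB Require Import structures.
From mathcomp Require Import all_boot all_order all_algebra.
From mathcomp Require Import all_classical all_reals all_analysis.
From mathcomp Require Import measurable_realfun.
From mathcomp Require Import ring lra.
From mathcomp Require Import complex.

Import Order.TTheory GRing.Theory Num.Theory.
Import numFieldNormedType.Exports.

Local Open Scope classical_set_scope.
Local Open Scope ring_scope.

(* A feasible point of the program yields the linear decision rules
   p(xi) = T W xi + p0 and y(xi) = Y xi + y0: since x is binary, the big-M
   constraints force theta_i, Gamma_i, omega_i, rho_i to be the products of x_i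
   with lambda, B_i^T T W, p0, (T W)^T b_i, and T, Lambda >= 0 are Farkas
   multipliers for the constraints over the support. Writing the integrand as
   [xi; 1]^T calQ [xi; 1] + xi^T Q xi + q^T xi, the equation
   r e e^T - calQ = H^T U H with U >= 0 bounds its first part by r wherever
   H [xi; 1] = W xi - h >= 0. The expectation of the rest is at most t by the
   two moment constraints: the trace of a product of positive semidefinite
   matrices is nonnegative, and Cauchy-Schwarz through the square root of
   Sigma0 handles the mean. *)

Set Implicit Arguments.
Unset Strict Implicit.
Unset Printing Implicit Defensive.

(** * Interpolation, positive semidefinite matrices and big-M products *)

Lemma polynomial_interpolation (F : fieldType) (s : seq F) (f : F -> F) :
  exists p : {poly F}, forall x, x \in s -> p.[x] = f x.
Proof.
elim: s => [|a s [p hp]]; first by exists 0.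
have [as_|as_] := boolP (a \in s).
  by exists p => x; rewrite inE => /orP[/eqP ->|]; exact: hp.
pose w := \prod_(y <- s) ('X - y%:P) : {poly F}.
have wa : w.[a] != 0.
  by have := root_prod_XsubC s a; rewrite (negbTE as_) => /negbT.
(* Newton's step: [w] vanishes at the earlier nodes and not at [a], so a multiple of it corrects the
   value at [a] only. *)
exists (p + ((f a - p.[a]) / w.[a]) *: w) => x; rewrite inE !hornerE.
have [-> _|_ /= xs] := eqVneq x a; first by rewrite divfK// subrKC.
have /eqP -> : w.[x] == 0 by have := root_prod_XsubC s x; rewrite xs.
by rewrite mulr0 addr0 hp.
Qed.

Section RealMatrices.
Context {R : realType}.

Lemma dotvE n (u v : 'cV[R]_n) : dotv u v = \sum_i u i 0 * v i 0.
Proof. by rewrite /dotv mxE; apply: eq_bigr => i _; rewrite mxE. Qed.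

Lemma dotvC n (u v : 'cV[R]_n) : dotv u v = dotv v u.
Proof. by rewrite !dotvE; apply: eq_bigr => i _; rewrite mulrC. Qed.

Lemma dotv_mull m n (A : 'M[R]_(m, n)) u v :
  dotv (A *m u) v = dotv u (A^T *m v).
Proof. by rewrite /dotv trmx_mul mulmxA. Qed.

Lemma dotvDl n (u u' v : 'cV[R]_n) : dotv (u + u') v = dotv u v + dotv u' v.
Proof. by rewrite /dotv linearD /= mulmxDl mxE. Qed.

Lemma dotvDr n (u v v' : 'cV[R]_n) : dotv u (v + v') = dotv u v + dotv u v'.
Proof. by rewrite /dotv mulmxDr mxE. Qed.

Lemma dotvZl n a (u v : 'cV[R]_n) : dotv (a *: u) v = a * dotv u v.
Proof. by rewrite /dotv linearZ /= -scalemxAl mxE. Qed.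

Lemma dotvZr n a (u v : 'cV[R]_n) : dotv u (a *: v) = a * dotv u v.
Proof. by rewrite /dotv -scalemxAr mxE. Qed.

Lemma dotvv_ge0 n (u : 'cV[R]_n) : 0 <= dotv u u.
Proof. by rewrite dotvE; apply: sumr_ge0 => i _; rewrite -expr2 sqr_ge0. Qed.

Lemma dotvv_gt0 n (u : 'cV[R]_n) : u != 0 -> 0 < dotv u u.
Proof.
move=> u0; rewrite lt_neqAle dotvv_ge0 andbT eq_sym; apply: contra_neq u0.
rewrite dotvE => /eqP.
rewrite psumr_eq0 => [/allP u0|i _]; last by rewrite -expr2 sqr_ge0.
apply/colP => i; have := u0 i (mem_index_enum i); rewrite mulf_eq0 orbb.
by rewrite mxE => /eqP.
Qed.

Lemma dotv_CauchySchwarz n (u v : 'cV[R]_n) : dotv u v <= enorm u * enorm v.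
Proof.
have [->|v0] := eqVneq v 0.
  by rewrite [leLHS]/dotv mulmx0 mxE mulr_ge0 ?sqrtr_ge0.
have vv := dotvv_gt0 v0.
have uv2 : dotv u v ^+ 2 <= dotv u u * dotv v v.
  rewrite -(ler_pM2l vv) -subr_ge0.
  (* The squared norm of this vector is [dotv v v] times the gap in the squared inequality. *)
  have := dotvv_ge0 (dotv v v *: u + (- dotv u v) *: v).
  rewrite !(dotvDl, dotvDr, dotvZl, dotvZr) (dotvC v u).
  by congr (0 <= _); ring.
rewrite /enorm -sqrtrM ?dotvv_ge0//; apply: le_trans (ler_norm _) _.
by rewrite -sqrtr_sqr ler_sqrt// mulr_ge0 ?dotvv_ge0.
Qed.

Local Notation toC := (real_complex R).

Lemma psdmx_eigenvalue_ge0 n (A : 'M[R]_n) a :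
  psdmx A -> eigenvalue A a -> 0 <= a.
Proof.
move=> [AT Apos] /eigenvalueP[v vA v0].
have vT0 : v^T != 0 by rewrite trmx_eq0.
have := Apos v^T.
have -> : A *m v^T = a *: v^T by rewrite -{1}AT -trmx_mul vA linearZ.
by rewrite dotvZr pmulr_lge0// dotvv_gt0.
Qed.

(** The complexification of [A] is Hermitian, hence diagonalizable with a real spectrum, which [s]
    lists. A polynomial that vanishes on [s] kills the diagonal form, hence [A] itself. *)
Lemma psdmx_annihilated n (A : 'M[R]_n.+1) : psdmx A ->
  exists2 s : seq R, {in s, forall x, 0 <= x} &
    forall p : {poly R}, {in s, forall x, p.[x] = 0} -> horner_mx A p = 0.
Proof.
move=> Apsd; have [AT Apos] := Apsd.
pose AC := map_mx toC A.
have AC_herm : AC \is hermsymmx.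
  apply: realsym_hermsym.
    by apply/is_hermitianmxP; rewrite expr0 scale1r map_mx_id// map_trmx AT.
  apply/mxOverP => i j; rewrite mxE.
  by rewrite complex_real.
have /orthomx_spectralP := hermitian_normalmx AC_herm.
have := hermitian_spectral_diag_real AC_herm.
have := spectral_unit AC.
set P := spectralmx AC; set L := spectral_diag AC => Pu Lreal.
clearbody P L => ACE.
pose s := [seq complex.Re (L 0 i) | i <- enum 'I_n.+1].
have LE i : L 0 i = toC (complex.Re (L 0 i)).
  have /mxOverP/(_ 0 i) := Lreal.
  by move/RRe_real => ->.
exists s.
  move=> _ /mapP[i _ ->]; apply: (psdmx_eigenvalue_ge0 Apsd).
  (* Row [i] of [P] is an eigenvector of the complexified matrix for [L 0 i]. Being a root of the
     characteristic polynomial is reflected by the field embedding, so the real number is an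
     eigenvalue of [A]. *)
  rewrite eigenvalue_root_char -(fmorph_root toC) map_char_poly -/AC /= -LE.
  rewrite -eigenvalue_root_char; apply/eigenvalueP; exists (row i P).
    rewrite -row_mul ACE !mulmxA mulmxV// mul1mx row_mul row_diag_mx.
    by rewrite -scalemxAl -rowE.
  apply/eqP => /(congr1 (mulmx^~ (invmx P))).
  rewrite mul0mx -row_mul mulmxV// => /rowP/(_ i); rewrite !mxE eqxx => /eqP.
  by rewrite oner_eq0.
move=> p hp; apply: (map_mx_inj (f := toC)).
rewrite map_mx0 map_horner_mx -/AC ACE.
rewrite horner_mx_uconjC; last exact: Pu.
rewrite horner_mx_diag.
suff -> : map_mx (horner (map_poly toC p)) L = 0.
  by rewrite linear0 mulmx0 mul0mx.
apply/rowP => i; rewrite !mxE LE horner_map hp ?rmorph0//.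
by apply: map_f; rewrite mem_enum.
Qed.

Lemma trmx_horner n (A : 'M[R]_n.+1) p : (horner_mx A p)^T = horner_mx A^T p.
Proof.
elim/poly_ind: p => [|p c IH]; first by rewrite !rmorph0 linear0.
rewrite !rmorphD !rmorphM /= linearD /= !horner_mx_X !horner_mx_C tr_scalar_mx.
rewrite trmx_mul IH; congr (_ + _).
exact: (comm_mx_horner p (comm_mx_refl A^T)).
Qed.

(* Interpolating fourth roots at the eigenvalues exhibits the root as the
   square of a symmetric matrix, which makes it positive semidefinite. *)
Lemma psdmx_sqrt_exists n (A : 'M[R]_n) : psdmx A ->
  exists S : 'M[R]_n, psdmx S /\ S *m S = A.
Proof.
case: n A => [A|n A Apsd].
  by exists A; split=> //; apply/matrixP => -[].
have [s s0 sA] := psdmx_annihilated Apsd.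
have [p hp] := polynomial_interpolation s (fun x => Num.sqrt (Num.sqrt x)).
pose K := horner_mx A p.
have KT : K^T = K by rewrite trmx_horner; case: Apsd => ->.
exists (K *m K); split; first split.
- by rewrite trmx_mul KT.
- by move=> z; rewrite -mulmxA -[X in X *m _]KT -dotv_mull dotvv_ge0.
(* The difference is the value at [A] of [p ^ 4 - 'X], which vanishes on the nonnegative nodes
   [s]. *)
- apply/eqP; rewrite -subr_eq0 -[A in _ - A]horner_mx_X.
  rewrite [K *m K](_ : _ = K * K)// [_ *m _](_ : _ = K * K * (K * K))//.
  rewrite -!rmorphM -rmorphB; apply/eqP; apply: sA => x xs.
  rewrite hornerD hornerN !hornerM hornerX hp// -!expr2.
  by rewrite !sqr_sqrtr ?sqrtr_ge0 ?s0// subrr.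
Qed.

(** Existence of a root ensures that [xget] does not return its default value 0. *)
Lemma mxsqrtP n (A : 'M[R]_n) : psdmx A ->
  psdmx (mxsqrt A) /\ mxsqrt A *m mxsqrt A = A.
Proof.
move=> /psdmx_sqrt_exists [S hS].
exact: (xgetPex 0 (ex_intro [set S : 'M[R]_n | psdmx S /\ S *m S = A] S hS)).
Qed.

Lemma pdmx_psd n (A : 'M[R]_n) : pdmx A -> psdmx A.
Proof.
move=> [AT Apos]; split=> // z; have [->|/Apos/ltW//] := eqVneq z 0.
by rewrite mulmx0 /dotv mulmx0 mxE.
Qed.

Lemma pdmx_unit n (A : 'M[R]_n) : pdmx A -> A \in unitmx.
Proof.
move=> [AT Apos]; rewrite -row_free_unit -kermx_eq0; apply/eqP/row_matrixP => i.
rewrite row0; apply/eqP; apply/negPn/negP => ri0.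
have := Apos (row i (kermx A))^T; rewrite trmx_eq0 => /(_ ri0).
have -> : A *m (row i (kermx A))^T = 0.
  by rewrite -{1}AT -trmx_mul -row_mul mulmx_ker row0 trmx0.
by rewrite /dotv mulmx0 mxE ltxx.
Qed.

(** With [B = S *m S], cyclicity turns the trace into that of [S *m A *m S], whose diagonal entries
    are values of the quadratic form of [A] at the columns of [S]. *)
Lemma mxdot_psd_ge0 n (A B : 'M[R]_n) : psdmx A -> psdmx B -> 0 <= mxdot A B.
Proof.
move=> [AT Apos] /psdmx_sqrt_exists[S [[ST _] <-]].
rewrite /mxdot AT mulmxA mxtrace_mulC; apply: sumr_ge0 => i _.
suff -> : (S *m (A *m S)) i i = dotv (col i S) (A *m col i S) by [].
have -> : A *m col i S = col i (A *m S) by rewrite !colE mulmxA.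
rewrite dotvE mxE; apply: eq_bigr => j _.
by congr (_ * _); [rewrite -{1}ST !mxE | rewrite [RHS]mxE].
Qed.

(** Bounds a linear function over an ellipsoid, the source of the norm term in the constraint on
    [t]. With [S] the root of [A], Cauchy-Schwarz applies to [S u] and [S^-1 v], and the squared
    norm of the latter is [v^T A^-1 v]. *)
Lemma dotv_ellipsoid n (A : 'M[R]_n) (u v : 'cV[R]_n) (g : R) : pdmx A ->
  dotv v (invmx A *m v) <= g -> dotv u v <= Num.sqrt g * enorm (mxsqrt A *m u).
Proof.
move=> Apd vg; have Au := pdmx_unit Apd.
have [[ST _] SS] := mxsqrtP (pdmx_psd Apd); set S := mxsqrt A in ST SS *.
have Su : S \in unitmx by move: Au; rewrite -SS unitmx_mul andbb.
have -> : dotv u v = dotv (S *m u) (invmx S *m v).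
  by rewrite dotv_mull ST mulKVmx.
apply: le_trans (dotv_CauchySchwarz _ _) _.
rewrite mulrC ler_wpM2r ?sqrtr_ge0// ler_wsqrtr//.
apply: le_trans vg; rewrite dotv_mull trmx_inv ST.
by rewrite -[invmx S *m (_ *m _)](mulKmx Au) -{2}SS -!mulmxA !mulKVmx.
Qed.

Lemma dotvNl n (u v : 'cV[R]_n) : dotv (- u) v = - dotv u v.
Proof. by rewrite /dotv linearN /= mulNmx mxE. Qed.

Lemma dotvNr n (u v : 'cV[R]_n) : dotv u (- v) = - dotv u v.
Proof. by rewrite /dotv mulmxN mxE. Qed.

Lemma dotv_col_mx m n (u u' : 'cV[R]_m) (v v' : 'cV[R]_n) :
  dotv (col_mx u v) (col_mx u' v') = dotv u u' + dotv v v'.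
Proof. by rewrite /dotv tr_col_mx mul_row_col mxE. Qed.

Lemma dotv_ge0 n (u v : 'cV[R]_n) : 0 <=mx u -> 0 <=mx v -> 0 <= dotv u v.
Proof.
move=> u0 v0; rewrite dotvE; apply: sumr_ge0 => i _.
by have := u0 i 0; have := v0 i 0; rewrite !mxE => *; rewrite mulr_ge0.
Qed.

Lemma mulmx_ge0 m n p (A : 'M[R]_(m, n)) (B : 'M[R]_(n, p)) :
  0 <=mx A -> 0 <=mx B -> 0 <=mx A *m B.
Proof.
move=> A0 B0 i j; rewrite !mxE; apply: sumr_ge0 => l _.
by have := A0 i l; have := B0 l j; rewrite !mxE => *; rewrite mulr_ge0.
Qed.

Lemma mxle_subr m n (A B : 'M[R]_(m, n)) : (0 <=mx B - A) <-> (A <=mx B).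
Proof.
by split=> AB i j; have := AB i j; rewrite !mxE subr_ge0.
Qed.

Lemma mxdotE m n (X Y : 'M[R]_(m, n)) : mxdot X Y = \sum_i \sum_j X i j * Y i j.
Proof.
rewrite exchange_big; apply: eq_bigr => j _; rewrite mxE.
by apply: eq_bigr => i _; rewrite mxE.
Qed.

Lemma dotv_outer n (a z : 'cV[R]_n) : dotv z (a *m a^T *m z) = dotv a z ^+ 2.
Proof.
rewrite -mulmxA [a^T *m z]mx11_scalar mul_mx_scalar dotvZr dotvC.
by rewrite expr2.
Qed.

Lemma mxdot_outer n (a : 'cV[R]_n) (Q : 'M[R]_n) :
  mxdot (a *m a^T) Q = dotv a (Q *m a).
Proof.
rewrite /mxdot trmx_mul trmxK -mulmxA mxtrace_mulC -mulmxA.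
by rewrite [a^T *m _]mx11_scalar mxtrace_scalar mulr1n.
Qed.

Lemma dotv_quadE n (u : 'cV[R]_n) (Q : 'M[R]_n) :
  dotv u (Q *m u) = \sum_i \sum_j Q i j * (u i 0 * u j 0).
Proof.
rewrite dotvE; apply: eq_bigr => i _; rewrite mxE mulr_sumr.
by apply: eq_bigr => j _; rewrite mulrCA.
Qed.

(** One pair of bounds always has coefficient 0 in front of [M]: the first pair forces [X = Y] at
    [x = 1], the second [X = 0] at [x = 0]. *)
Lemma bigM_mxE m n (x M : R) (X Y : 'M[R]_(m, n)) : x = 0 \/ x = 1 ->
  [/\ Y - ((1 - x) * M) *: const_mx 1 <=mx X,
      X <=mx Y + ((1 - x) * M) *: const_mx 1,
      - ((x * M) *: const_mx 1) <=mx X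
    & X <=mx (x * M) *: const_mx 1] -> X = x *: Y.
Proof.
move=> x01 [h1 h2 h3 h4]; apply/matrixP => i j.
move: (h1 i j) (h2 i j) (h3 i j) (h4 i j); rewrite !mxE.
by case: x01 => ->; lra.
Qed.

Lemma bigM_scalarE (x M th lam : R) : x = 0 \/ x = 1 ->
  [/\ lam - M * (1 - x) <= th, th <= M * x, 0 <= th & th <= lam] ->
  th = x * lam.
Proof. by case=> -> [h1 h2 h3 h4]; lra. Qed.

End RealMatrices.

(** * Expectations of continuous functions under a law carried by a compact set *)

Section CarriedByCompact.
Context {R : realType} {k : nat}.
Variables (F : probability (borel_cV R k) R) (S : set 'cV[R]_k).
Hypotheses (compS : compact S) (FS : F S = 1%E).

Local Notation borel_fun g := (g : borel_cV R k -> R).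
Local Notation Ef g := (fine (@expectation _ _ _ F g%R)).

Lemma continuous_borel_measurable (g : 'cV[R]_k -> R) :
  continuous g -> measurable_fun [set: borel_cV R k] (borel_fun g).
Proof.
move=> /continuousP cg; apply: (measurability _ (RGenOpens.measurableE R)).
move=> _ [_ [a [b ->] <-]]; rewrite setTI; apply: sub_sigma_algebra.
by apply: cg; exact: interval_open.
Qed.

Lemma compact_borel_measurable : measurable (S : set (borel_cV R k)).
Proof.
rewrite -(setCK S); apply: (@measurableC _ (borel_cV R k)).
apply: sub_sigma_algebra; rewrite /= openC; apply: compact_closed => //.
Qed.

Let mS := compact_borel_measurable.

Let FSC : F (~` S) = 0%E.
Proof. by rewrite probability_setC// FS subee. Qed.

(** A continuous [g] may be unbounded on the whole space, but it is bounded on the compact [S],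
    whose complement is null. Hence [fine] loses nothing on these expectations. *)
Lemma continuous_integrable (g : 'cV[R]_k -> R) :
  continuous g -> F.-integrable setT (EFin \o borel_fun g).
Proof.
move=> cg; have mg := continuous_borel_measurable cg.
have /measurable_EFinP mEg := mg.
apply/(negligible_integrable (measurableC mS) measurableT mEg FSC).
rewrite setTD setCK; apply: measurable_bounded_integrable => //.
- by apply: le_lt_trans (probability_le1 F mS) (ltry _).
- exact: measurable_funTS.
have /compact_bounded[M [Mr hM]] : compact (g @` S).
  by apply: continuous_compact => //; exact: continuous_subspaceT.
by exists M; split=> // y My x Sx; apply: hM My _ _; exists x.
Qed.

Lemma continuous_expectation_fin_num (g : 'cV[R]_k -> R) :
  continuous g -> 'E_F[borel_fun g]%E \is a fin_num.
Proof.
by move=> cg; rewrite unlock integrable_fin_num//; exact: continuous_integrable.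
Qed.

Lemma fine_expectation_carried (g : 'cV[R]_k -> R) : continuous g ->
  Ef g = (\int[F]_(x in (S : set (borel_cV R k))) g x)%R.
Proof.
move=> cg; have ig := continuous_integrable cg.
rewrite unlock (negligible_integral (measurableC mS) measurableT ig FSC).
by rewrite setTD setCK.
Qed.

(** Both expectations are integrals over [S], so comparing on the support is enough; the bound by
    [r] holds only there. *)
Lemma le_fine_expectation (f g : 'cV[R]_k -> R) :
  continuous f -> continuous g ->
  (forall x, S x -> f x <= g x) -> Ef f <= Ef g.
Proof.
move=> cf cg fg; rewrite !fine_expectation_carried//; apply: le_Rintegral => //.
- by apply: integrableS (continuous_integrable cf).
- by apply: integrableS (continuous_integrable cg).
Qed.

Lemma fine_expectationD (f g : 'cV[R]_k -> R) : continuous f -> continuous g ->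
  Ef (fun x => f x + g x) = Ef f + Ef g.
Proof.
move=> cf cg; rewrite unlock; apply: RintegralD => //;
  exact: continuous_integrable.
Qed.

Lemma fine_expectationZ a (f : 'cV[R]_k -> R) : continuous f ->
  Ef (fun x => a * f x) = a * Ef f.
Proof.
by move=> cf; rewrite unlock; apply: RintegralZl => //;
  exact: continuous_integrable.
Qed.

Lemma fine_expectation_cst a : Ef (cst a) = a.
Proof. by rewrite expectation_cst. Qed.

Lemma continuous_bigsum (I : Type) (r : seq I) (f : I -> 'cV[R]_k -> R) :
  (forall i, continuous (f i)) -> continuous (fun x => \sum_(i <- r) f i x).
Proof. by move=> cf; apply: continuous_big => //; exact: add_continuous. Qed.

Lemma fine_expectation_sum (I : Type) (r : seq I) (f : I -> 'cV[R]_k -> R) :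
  (forall i, continuous (f i)) ->
  Ef (fun x => \sum_(i <- r) f i x) = \sum_(i <- r) Ef (f i).
Proof.
move=> cf; elim: r => [|i r IH].
  by under eq_fun do rewrite big_nil; rewrite fine_expectation_cst big_nil.
under eq_fun do rewrite big_cons.
by rewrite fine_expectationD// ?IH ?big_cons//; exact: continuous_bigsum.
Qed.

End CarriedByCompact.

(** * Expectation of a quadratic function under the moment constraints *)

Section LdrBound.
Context {R : realType} {d n m k l : nat}.
Variable D : ldr_data R d n m k l.

(** The left side is the mean of [xi^T Q xi + q^T xi] expanded around [mu0]. The second-moment
    constraint bounds its trace term, since [Q] is positive semidefinite, and the ellipsoid
    constraint bounds the term in the mean. *)
Lemma moment_bound (F : probability (borel_cV R k) R)
    (Q : 'M[R]_k) (q : 'cV[R]_k) :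
  pdmx (dSigma0 D) -> ambiguity_set D F -> psdmx Q ->
  mxdot (second_moment D F) Q
   + dotv (q + 2 *: (Q *m dmu0 D)) (mean F - dmu0 D)
   + dotv (dmu0 D) (Q *m dmu0 D) + dotv (dmu0 D) q
  <= mxdot (dgamma2 D *: dSigma0 D + dmu0 D *m (dmu0 D)^T) Q + dotv (dmu0 D) q
     + Num.sqrt (dgamma1 D)
       * enorm (mxsqrt (dSigma0 D) *m (q + 2 *: (Q *m dmu0 D))).
Proof.
move=> Spd [_ hmean hmom] Qpsd.
have := dotv_ellipsoid (q + 2 *: (Q *m dmu0 D)) Spd hmean.
have := mxdot_psd_ge0 hmom Qpsd.
(* Reading [mu0^T Q mu0] as the trace product of [mu0 mu0^T] with [Q] leaves an inequality linear in
   common terms. *)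
rewrite -mxdot_outer /mxdot !linearD /= !linearN /= !mulmxDl !mulNmx.
rewrite !linearD /= !linearN /=.
lra.
Qed.

Lemma fine_expectation_quadratic (F : probability (borel_cV R k) R)
    (Q : 'M[R]_k) (q : 'cV[R]_k) (a : R) :
  compact (support_set D) -> F (support_set D) = 1%E -> Q^T = Q ->
  fine (@expectation _ _ _ F
    (fun xi : 'cV[R]_k => a + dotv xi (Q *m xi) + dotv q xi)) =
  a + (mxdot (second_moment D F) Q
   + dotv (q + 2 *: (Q *m dmu0 D)) (mean F - dmu0 D)
   + dotv (dmu0 D) (Q *m dmu0 D) + dotv (dmu0 D) q).
Proof.
move=> cS FS QT; set mu := dmu0 D.
have ccoord i : continuous (fun xi : 'cV[R]_k => xi i 0).
  exact: coord_continuous.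
have cdev1 i : continuous (fun xi : 'cV[R]_k => (xi - mu) i 0).
  have -> : (fun xi : 'cV[R]_k => (xi - mu) i 0) = (fun xi => xi i 0 - mu i 0).
    by apply/funext => xi; rewrite !mxE.
  by move=> xi; apply: continuousB; [exact: ccoord | exact: cst_continuous].
have cdev i j : continuous (fun xi : 'cV[R]_k => (xi - mu) i 0 * (xi - mu) j 0).
  by move=> xi; apply: continuousM; exact: cdev1.
have cZ c (f : 'cV[R]_k -> R) : continuous f -> continuous (fun xi => c * f xi).
  by move=> cf xi; apply: continuousM; [exact: cst_continuous|exact: cf].
(* Centering the quadratic part at [mu] leaves only the centered second moments and the mean, which
   linearity then extracts entry by entry. *)
have -> : (fun xi : 'cV[R]_k => a + dotv xi (Q *m xi) + dotv q xi) =
  (fun xi => (\sum_i \sum_j Q i j * ((xi - mu) i 0 * (xi - mu) j 0))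
     + (\sum_i (q + 2 *: (Q *m mu)) i 0 * xi i 0
     + (a - dotv mu (Q *m mu)))).
  apply/funext => xi; rewrite -dotv_quadE -dotvE.
  rewrite mulmxBr !(dotvDl, dotvDr, dotvNl, dotvNr, dotvZl) -!/mu.
  (* Symmetry of [Q] merges the two cross terms into the factor 2. *)
  have -> : dotv mu (Q *m xi) = dotv (Q *m mu) xi by rewrite dotv_mull QT.
  by rewrite (dotvC xi (Q *m mu)); ring.
have cq i : continuous (fun xi : 'cV[R]_k =>
    \sum_j Q i j * ((xi - mu) i 0 * (xi - mu) j 0)).
  by apply: continuous_bigsum => j; exact: cZ.
have cl : continuous (fun xi : 'cV[R]_k =>
    \sum_i (q + 2 *: (Q *m mu)) i 0 * xi i 0).
  by apply: continuous_bigsum => i; exact: cZ.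
have cla : continuous (fun xi : 'cV[R]_k =>
    \sum_i (q + 2 *: (Q *m mu)) i 0 * xi i 0 + (a - dotv mu (Q *m mu))).
  by move=> xi; exact: (cvgD (cl xi) (cvg_cst _)).
rewrite (fine_expectationD cS FS (continuous_bigsum cq) cla).
rewrite (fine_expectationD cS FS cl); last exact: cst_continuous.
rewrite expectation_cst /=.
rewrite (fine_expectation_sum cS FS _ cq).
rewrite (fine_expectation_sum cS FS); last by move=> i; exact: cZ.
have -> : mxdot (second_moment D F) Q = \sum_i fine (@expectation _ _ _ F
    (fun xi => \sum_j Q i j * ((xi - mu) i 0 * (xi - mu) j 0))).
  rewrite mxdotE; apply: eq_bigr => i _.
  rewrite (fine_expectation_sum cS FS); last by move=> j; exact: cZ.
  apply: eq_bigr => j _; rewrite (fine_expectationZ cS FS); last exact: cdev.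
  by rewrite mulrC mxE.
have -> : \sum_i fine (@expectation _ _ _ F
    (fun xi : 'cV[R]_k => (q + 2 *: (Q *m mu)) i 0 * xi i 0)) =
    dotv (q + 2 *: (Q *m mu)) (mean F).
  rewrite dotvE; apply: eq_bigr => i _.
  rewrite (fine_expectationZ cS FS); last exact: ccoord.
  by rewrite [mean F _ _]mxE.
rewrite !(dotvDl, dotvDr, dotvNl, dotvNr, dotvZl).
by rewrite (dotvC mu q) (dotvC mu (Q *m mu)); ring.
Qed.

End LdrBound.

(** * From a feasible point of the semidefinite program to linear decision rules *)

Section SdpToLdr.
Context {R : realType} {d n m k l : nat}.
Variables (D : ldr_data R d n m k l) (M : R).
Hypothesis binX : dX D `<=` binary_cube.

Definition ldr_of_sdp (z : sdp_var R d n m k l) : ldr_var R d n m k :=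
  LdrVar (vx z) (vlam z) (vT z *m dW D) (vp0 z) (vY z) (vy0 z).

(** On the support [W xi - h] is nonnegative. There [p(xi)] equals [T (W xi - h) + (T h + p0)], and
    the slack of the last constraint equals [Lambda (W xi - h)] plus the vector
    [Lambda h - A y0 + lambda b_x0], all summands being nonnegative. *)
Lemma ldr_of_sdp_feasible z : FM D M z -> ldr_feasible D (ldr_of_sdp z).
Proof.
move=> [xX [[_ _ lam0] [_ [hth [_ [_ [[hA hAy hLam] [hC hc hT T0]]]]]]]].
split=> // xi hxi; rewrite /ldr_pfun /ldr_yfun /bfun /cfun /vfun /=.
have Wxi : 0 <=mx dW D *m xi - dh D by apply/mxle_subr.
split.
- by rewrite -hC -hc !mulmxDr mulmxDl -!scalemxAl scalerDr !mulmxA addrACA.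
- have -> : vT z *m dW D *m xi + vp0 z =
     vT z *m (dW D *m xi - dh D) + (vT z *m dh D + vp0 z).
    by rewrite mulmxBr mulmxA addrA subrK.
  move=> i j; have := mulmx_ge0 T0 Wxi i j; have := hT i j.
  by rewrite !mxE => *; rewrite addr_ge0.
- have xth i : vtheta z i = vx z i 0 * vlam z.
    by apply: (bigM_scalarE (M := M)); [exact: binX | have [] := hth i].
  apply/mxle_subr.
  have Bxth : \sum_i vtheta z i *: dB D i + vlam z *: dB0 D =
      vlam z *: Bx D (vx z).
    rewrite /Bx scalerDr scaler_sumr; congr (_ + _); apply: eq_bigr => i _.
    by rewrite xth scalerA mulrC.
  have bxth : \sum_i vtheta z i *: db D i + vlam z *: db0 D =
      vlam z *: bx0 D (vx z).
    rewrite /bx0 scalerDr scaler_sumr; congr (_ + _); apply: eq_bigr => i _.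
    by rewrite xth scalerA mulrC.
  move: hAy; rewrite -addrA bxth; rewrite Bxth in hA => hAy.
  have -> : vlam z *: (Bx D (vx z) *m xi + bx0 D (vx z))
      - dA D *m (vY z *m xi + vy0 z) =
      vLam z *m (dW D *m xi - dh D)
      + (vLam z *m dh D - dA D *m vy0 z + vlam z *: bx0 D (vx z)).
    rewrite scalerDr scalemxAl -hA mulmxDl mulmxDr mulmxBr !mulmxA.
    by apply/matrixP => i j; rewrite !mxE; ring.
  move=> i j; have := mulmx_ge0 hLam Wxi i j; have := hAy i j.
  by rewrite !mxE => *; rewrite addr_ge0.
Qed.

(** With the products by [x_i] resolved, [N] is [B_x^T T W + C^T Y] and [2 g + q] is the linear
    coefficient of the integrand. The last two terms on the right restore the [Q] and [q] subtracted
    inside [calQ]. *)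
Lemma ldr_integrandE z xi : FM D M z ->
  dotv (bfun D (vx z) xi) (ldr_pfun (ldr_of_sdp z) xi)
   + dotv (cfun D xi) (ldr_yfun (ldr_of_sdp z) xi)
  = dotv (col_mx xi 1%:M) (calQ D z *m col_mx xi 1%:M)
    + dotv xi (vQ z *m xi) + dotv (vq z) xi.
Proof.
move=> [xX [_ [hG [_ [hom [hrho _]]]]]].
have x01 i : vx z i 0 = 0 \/ vx z i 0 = 1 := binX xX i.
have NE : Nmx D z = (Bx D (vx z))^T *m (vT z *m dW D) + (dC D)^T *m vY z.
  rewrite /Nmx /Bx linearD linear_sum /= mulmxDl mulmx_suml.
  congr (_ + _ + _); apply: eq_bigr => i _.
  by rewrite (bigM_mxE (x01 i) (hG i)) linearZ /= scalemxAl.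
have omE : \sum_i (dB D i)^T *m vomega z i + (dB0 D)^T *m vp0 z
    = (Bx D (vx z))^T *m vp0 z.
  rewrite /Bx linearD linear_sum /= mulmxDl mulmx_suml.
  congr (_ + _); apply: eq_bigr => i _.
  by rewrite (bigM_mxE (x01 i) (hom i)) -scalemxAr [in RHS]linearZ /= scalemxAl.
have rhoE : \sum_i vrho z i + (vT z *m dW D)^T *m db0 D
    = (vT z *m dW D)^T *m bx0 D (vx z).
  rewrite /bx0 mulmxDr mulmx_sumr.
  congr (_ + _); apply: eq_bigr => i _.
  by rewrite (bigM_mxE (x01 i) (hrho i)) -scalemxAr.
have gE : gvec D z = 2^-1 *: ((Bx D (vx z))^T *m vp0 z
    + (vT z *m dW D)^T *m bx0 D (vx z) + (dC D)^T *m vy0 z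
    + (vY z)^T *m dc0 D - vq z).
  by rewrite /gvec omE -rhoE !addrA.
(* Generalizing these four objects keeps only their closed forms, so the rest is an identity between
   inner products. *)
rewrite /bfun /calQ; move: {omE rhoE} (Bx D _) (bx0 D _) (Nmx D z) (gvec D z)
  NE gE => Bz bz N g NE gE.
have dotv1l (w : 'cV[R]_1) : dotv 1%:M w = w 0 0.
  by rewrite /dotv trmx1 mul1mx.
have xiN : dotv xi (N *m xi) = dotv (Bz *m xi) (vT z *m dW D *m xi)
    + dotv (dC D *m xi) (vY z *m xi).
  by rewrite NE mulmxDl dotvDr -!mulmxA -!dotv_mull.
have xig : dotv xi g = 2^-1 * (dotv (Bz *m xi) (vp0 z)
    + dotv (vT z *m dW D *m xi) (bz) + dotv (dC D *m xi) (vy0 z)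
    + dotv (vY z *m xi) (dc0 D) - dotv xi (vq z)).
  by rewrite gE dotvZr !dotvDr dotvNr -!dotv_mull.
rewrite mul_block_col dotv_col_mx dotv1l !mulmx1.
rewrite [(g^T *m xi + _) 0 0]mxE -/(dotv g xi).
rewrite [_%:M 0 0]mxE mulr1n (dotvC g).
rewrite mulmxBl -scalemxAl mulmxDl !(dotvDr, dotvNr, dotvZr).
(* Symmetrizing [N] does not change its quadratic form. *)
have -> : dotv xi ((N)^T *m xi) = dotv xi (N *m xi).
  by rewrite -dotv_mull dotvC.
rewrite xiN xig /cfun /ldr_pfun /ldr_yfun /= !(dotvDl, dotvDr).
rewrite (dotvC (vq z)) (dotvC (bz) (_ *m xi)) (dotvC (dc0 D) (_ *m xi)).
by field.
Qed.

(** An entrywise nonnegative [U] certifies that [r e e^T - calQ] is copositive over the cone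
    [Xihat]. The vector [v] lies in that cone, and its last coordinate 1 makes the first term equal
    to [r]. *)
Lemma quadratic_le z U xi : sdp_feasible D M (z, U) -> support_set D xi ->
  dotv (col_mx xi 1%:M) (calQ D z *m col_mx xi 1%:M) <= vr z.
Proof.
move=> [_ _ hU U0] Sxi; set v := col_mx xi 1%:M.
have e1 : dotv e_last v = 1.
  by rewrite /dotv /e_last trmx_delta -rowE mxE /v col_mxEd mxE.
have Hv : Hmx D *m v = dW D *m xi - dh D.
  by rewrite /Hmx mul_row_col mulmx1.
have : 0 <= dotv v ((Hmx D)^T *m U *m Hmx D *m v).
  have Hv0 : 0 <=mx Hmx D *m v by rewrite Hv; apply/mxle_subr.
  by rewrite -!mulmxA -dotv_mull; apply: dotv_ge0 => //; exact: mulmx_ge0.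
rewrite -hU mulmxBl -scalemxAl dotvDr dotvNr dotvZr dotv_outer e1 expr1n mulr1.
by rewrite subr_ge0.
Qed.

(** On the support the integrand is at most [r + xi^T Q xi + q^T xi], whose mean is computed exactly
    and bounded by the moment constraints and the constraint on [t]. *)
Lemma ldr_expectation_le z U F : compact (support_set D) -> pdmx (dSigma0 D) ->
  sdp_feasible D M (z, U) -> ambiguity_set D F ->
  ('E_F[fun xi : 'cV[R]_k =>
     (dotv (bfun D (vx z) xi) (ldr_pfun (ldr_of_sdp z) xi)
      + dotv (cfun D xi) (ldr_yfun (ldr_of_sdp z) xi))%R]
   <= (vr z + vt z)%:E)%E.
Proof.
move=> cS Spd zU FD; have [FS _ _] := FD; have [zF _ _ _] := zU.
have [_ [[tz Qpsd _] _]] := zF.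
have cdot p (u v : 'cV[R]_k -> 'cV[R]_p) :
    (forall i, continuous (fun xi => u xi i 0)) ->
    (forall i, continuous (fun xi => v xi i 0)) ->
    continuous (fun xi => dotv (u xi) (v xi)).
  move=> cu cv; under eq_fun do rewrite dotvE.
  apply: continuous_bigsum => i xi.
  by apply: continuousM; [exact: cu | exact: cv].
have caff p (A : 'M[R]_(p, k)) (a : 'cV[R]_p) i :
    continuous (fun xi : 'cV[R]_k => (A *m xi + a) i 0).
  have cA : continuous (fun xi : 'cV[R]_k => \sum_j A i j * xi j 0).
    apply: continuous_bigsum => j xi.
    by apply: continuousM; [exact: cst_continuous | exact: coord_continuous].
  under eq_fun do rewrite !mxE.
  by move=> xi; exact: (cvgD (cA xi) (cvg_cst _)).
have clin p (A : 'M[R]_(p, k)) i :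
    continuous (fun xi : 'cV[R]_k => (A *m xi) i 0).
  by have := caff p A 0 i; under eq_fun do rewrite addr0.
have cobj : continuous (fun xi : 'cV[R]_k =>
    dotv (bfun D (vx z) xi) (ldr_pfun (ldr_of_sdp z) xi)
    + dotv (cfun D xi) (ldr_yfun (ldr_of_sdp z) xi)).
  have c1 : continuous (fun xi : 'cV[R]_k =>
      dotv (bfun D (vx z) xi) (ldr_pfun (ldr_of_sdp z) xi)).
    by apply: cdot => i; exact: caff.
  have c2 : continuous (fun xi : 'cV[R]_k =>
      dotv (cfun D xi) (ldr_yfun (ldr_of_sdp z) xi)).
    by apply: cdot => i; exact: caff.
  by move=> xi; exact: (cvgD (c1 xi) (c2 xi)).
have cquad : continuous (fun xi : 'cV[R]_k =>
    vr z + dotv xi (vQ z *m xi) + dotv (vq z) xi).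
  have c1 : continuous (fun xi : 'cV[R]_k => dotv xi (vQ z *m xi)).
    by apply: cdot => i; [exact: coord_continuous | exact: clin].
  have c2 : continuous (fun xi : 'cV[R]_k => dotv (vq z) xi).
    by apply: cdot => i; [exact: cst_continuous | exact: coord_continuous].
  by move=> xi; exact: (cvgD (cvgD (cvg_cst _) (c1 xi)) (c2 xi)).
(* The expectation is finite, which reduces the claim to an inequality between reals. *)
rewrite -[leLHS]fineK; last exact: (continuous_expectation_fin_num cS FS).
rewrite lee_fin.
apply: le_trans (le_fine_expectation cS FS cobj cquad _) _.
  move=> xi Sxi; rewrite ldr_integrandE// !lerD2r.
  exact: quadratic_le zU Sxi.
rewrite (fine_expectation_quadratic _ _ cS FS); last by case: Qpsd.
rewrite lerD2l; apply: le_trans (moment_bound _ Spd FD Qpsd) _.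
exact: tz.
Qed.

End SdpToLdr.

(** * Comparison of the optimal values *)

Theorem corollary2 (R : realType) (d n m k l : nat)
  (D : ldr_data R d n m k l) (M : R)
  (hX : dX D `<=` binary_cube)
  (hS : compact (support_set D))
  (hSigma0 : pdmx (dSigma0 D))
  (hgamma1 : 0 <= dgamma1 D)
  (hgamma2 : 1 <= dgamma2 D)
  (hL2 : forall F, ambiguity_set D F ->
    [/\ square_integrable F (cfun D),
        square_integrable F (vfun D)
      & forall x, dX D x -> square_integrable F (bfun D x)])
  (hlower : forall x F, dX D x -> ambiguity_set D F ->
    {ae F, forall xi, lower_set D x xi !=set0 /\
                      bounded_set (lower_set D x xi)})
  (hXihat : full_dimensional (Xihat D))
  (hM : 0 < M) :
  (ldr_value D <= sdp_value D M)%E.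
Proof.
apply: le_ereal_inf_tmp => _ [[z U] zU <-].
apply: ge_ereal_inf; exists (ldr_objective D (ldr_of_sdp D z)).
  exists (ldr_of_sdp D z) => //.
  by have [zF _ _ _] := zU; exact: ldr_of_sdp_feasible zF.
(* Both objectives contain the same [w^T x], so it remains to bound the worst-case expectation by
   [r + t], one law at a time. *)
rewrite /sdp_objective -addrA EFinD; apply: leeD => //.
apply: ge_ereal_sup => _ [F FD <-].
exact: ldr_expectation_le zU FD.
Qed.
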